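(* Let $S_0,V_0,K>0$ and let $\mathcal{I}_\rho(S_0,V_0,K)$ be defined for $\rho\in(-1,1)$ as in the context. Then for every $\rho\in(-1,1)$, $$\frac{1}{1+|\rho|}\,\mathcal{I}_0(S_0,V_0,K)\le\mathcal{I}_\rho(S_0,V_0,K)\le\frac{1}{1-|\rho|}\,\mathcal{I}_0(S_0,V_0,K),$$ where $\mathcal{I}_0$ is $\mathcal{I}_\rho$ at $\rho=0$.
   Context: Let $\eta,\sigma:(0,\infty)\to(0,\infty)$ be (Borel measurable) functions. For $\rho\in(-1,1)$ and absolutely continuous $g,h:[0,1]\to\mathbb{R}$ set $$\Lambda_\rho[g,h]=\frac{1}{2(1-\rho^2)}\int_0^1\left(\frac{g'(t)}{\eta(e^{g(t)})\sqrt{e^{h(t)}}}-\frac{\rho h'(t)}{\sigma(e^{h(t)})}\right)^2dt+\frac12\int_0^1\left(\frac{h'(t)}{\sigma(e^{h(t)})}\right)^2dt,$$ and let $$\mathcal{I}_\rho(S_0,V_0,K)=\inf\left\{\Lambda_\rho[g,h]:\ g(0)=\log S_0,\ h(0)=\log V_0,\ \int_0^1e^{h(t)}\eta^2(e^{g(t)})\,dt=K\right\}.$$ *)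

(* Defs.v *)
From HB Require Import structures.
From mathcomp Require Import all_boot all_order all_algebra.
From mathcomp Require Import all_classical all_reals all_analysis.

Set Implicit Arguments.
Unset Strict Implicit.
Unset Printing Implicit Defensive.

Import Order.TTheory GRing.Theory Num.Theory.
Import numFieldNormedType.Exports.

Local Open Scope classical_set_scope.
Local Open Scope ring_scope.

(* A finite family of subintervals of [a, b] is non-overlapping when the
   corresponding open intervals are pairwise disjoint. *)
Definition absolutely_continuous (R : realType) (a b : R) (f : R -> R) : Prop :=
  forall e : R, 0 < e -> exists2 d : R, 0 < d &
    forall (n : nat) (x y : 'I_n -> R),
      (forall i, a <= x i /\ x i <= y i /\ y i <= b) ->
      trivIset setT (fun i => [set` `]x i, y i[]) ->
      \sum_(i < n) (y i - x i) < d ->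
      \sum_(i < n) `|f (y i) - f (x i)| < e.

(* Paths on [0, 1] are total functions R -> R of which only the restriction to
   [0, 1] matters: derive1 g t for 0 < t < 1 does not depend on the values of g
   outside [0, 1], and the endpoints are Lebesgue-null.  An absolutely
   continuous g is differentiable at almost every point of [0, 1].  The value
   of the functional is in [0, +oo]. *)
Definition Lambda (R : realType) (eta sigma : R -> R) (rho : R)
    (g h : R -> R) : \bar R :=
  ((2 * (1 - rho ^+ 2))^-1%:E *
     \int[lebesgue_measure]_(t in `[0%R, 1%R])
       ((derive1 g t / (eta (expR (g t)) * Num.sqrt (expR (h t)))
         - rho * derive1 h t / sigma (expR (h t))) ^+ 2)%:E
   + (2^-1)%:E *
     \int[lebesgue_measure]_(t in `[0%R, 1%R])
       ((derive1 h t / sigma (expR (h t))) ^+ 2)%:E)%E.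

Definition admissible (R : realType) (eta : R -> R) (S0 V0 K : R)
    : set ((R -> R) * (R -> R)) :=
  [set gh | [/\ absolutely_continuous 0 1 gh.1,
                absolutely_continuous 0 1 gh.2,
                gh.1 0 = ln S0,
                gh.2 0 = ln V0 &
                (\int[lebesgue_measure]_(t in `[0%R, 1%R])
                   (expR (gh.2 t) * eta (expR (gh.1 t)) ^+ 2)%:E = K%:E)%E]].

(* The infimum over the empty set is +oo. *)
Definition rate (R : realType) (eta sigma : R -> R) (rho S0 V0 K : R) : \bar R :=
  ereal_inf [set Lambda eta sigma rho gh.1 gh.2 | gh in admissible eta S0 V0 K].

(* Main.v *)
(* The integrand of Lambda_rho is the quadratic form
   (x^2 - 2 rho x y + y^2) / (2 (1 - rho^2)) in the normalized speeds
   x = g' / (eta(e^g) sqrt(e^h)) and y = h' / sigma(e^h).  As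
   |2 rho x y| <= |rho| (x^2 + y^2), it lies between (1 + |rho|)^-1 and
   (1 - |rho|)^-1 times its value at rho = 0; integrate and take infima.
   Merging the two integrals of Lambda_rho into one requires measurable
   integrands, hence the measurability of the derivative of a continuous
   function. *)
Require Import Defs.
From HB Require Import structures.
From mathcomp Require Import all_boot all_order all_algebra.
From mathcomp Require Import all_classical all_reals all_analysis.
From mathcomp Require Import measurable_realfun ring lra.
Import Order.TTheory GRing.Theory Num.Theory.
Import numFieldNormedType.Exports.
Local Open Scope classical_set_scope.
Local Open Scope ring_scope.

(** * Continuity and measurability of absolutely continuous paths *)

(** For [a <= b], the projection onto [[a, b]]. Since a path is arbitrary outside the interval,
    [f \o clamp a b] replaces it by its constant extension beyond the endpoints. *)
Definition clamp {R : realType} (a b x : R) : R := Num.max a (Num.min b x).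

Lemma clamp_itv {R : realType} (a b x : R) :
  a <= b -> a <= clamp a b x <= b.
Proof.
move=> ab; rewrite /clamp le_max lexx/= ge_max ab/= ge_min lexx//.
Qed.

Lemma clamp_id {R : realType} (a b x : R) : a <= x <= b -> clamp a b x = x.
Proof. by move=> /andP[ax xb]; rewrite /clamp (min_r xb) (max_r ax). Qed.

Lemma clamp_le {R : realType} (a b x y : R) :
  x <= y -> clamp a b x <= clamp a b y <= clamp a b x + (y - x).
Proof.
move=> xy; rewrite /clamp; case: (leP b x); case: (leP b y);
  case: (leP a b); case: (leP a x); case: (leP a y); lra.
Qed.

(** Families of a single interval already give uniform continuity on [[a, b]]. *)
Lemma absolutely_continuous_dist {R : realType} (a b : R) (f : R -> R) :
  absolutely_continuous a b f -> forall e, 0 < e -> exists2 d, 0 < d &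
  forall x y, a <= x -> x <= y -> y <= b -> y - x < d -> `|f y - f x| < e.
Proof.
move=> fac e e0; have [d d0 fd] := fac e e0; exists d => // x y ax xy yb yxd.
have := fd 1%N (fun=> x) (fun=> y); rewrite !big_ord1; apply => //.
by move=> i j _ _ _; rewrite !ord1.
Qed.

(** As [clamp] is nondecreasing and 1-Lipschitz, the uniform modulus [d] of [f] also serves for the
    composite. *)
Lemma absolutely_continuous_clamp {R : realType} (a b : R) (f : R -> R) :
  a <= b -> absolutely_continuous a b f -> continuous (f \o clamp a b).
Proof.
move=> ab /absolutely_continuous_dist fac x.
apply/cvgrPdist_lt => e /fac[d d0 fd].
near=> y => /=.
have : `|x - y| < d by near: y; apply: cvgr_dist_lt => //; exact: cvg_id.
rewrite ltr_norml => /andP[yx xy].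
have /andP[ax xb] := clamp_itv a b x ab.
have /andP[ay yb] := clamp_itv a b y ab.
have [xley|/ltW ylex] := leP x y.
  have /andP[? ?] := clamp_le a b x y xley.
  by rewrite distrC; apply: fd => //; lra.
have /andP[? ?] := clamp_le a b y x ylex.
by apply: fd => //; lra.
Unshelve. all: by end_near. Qed.

Lemma absolutely_continuous_measurable {R : realType} (a b : R) (f : R -> R) :
  a <= b -> absolutely_continuous a b f -> measurable_fun (`[a, b] : set R) f.
Proof.
move=> ab fac; apply: (eq_measurable_fun (f \o clamp a b)).
  by move=> x; rewrite inE/= in_itv/= => xab; rewrite clamp_id.
by apply: measurable_funTS; apply: continuous_measurable_fun;
  exact: absolutely_continuous_clamp.
Qed.

(** * Measurability of the derivative *)

(** Shaped like the quotient inside [derive1], so that [derive1 f x] is by definition the limit of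
    [diffq f ^~ x] at [0^']. *)
Definition diffq {R : realType} (f : R -> R) (h x : R) : R :=
  h^-1 *: (f (h + x) - f x).

(** Oscillation of the quotients replaces distance to their limit, so the derivative need not be
    known to exist; the bound is non-strict to keep the set closed. *)
Definition osc_diffq_le {R : realType} (f : R -> R) (k n : nat) : set R :=
  \bigcap_(p in [set p : R * R | [/\ p.1 != 0, p.2 != 0,
      `|p.1| < n.+1%:R^-1 & `|p.2| < n.+1%:R^-1]])
    [set x | `|diffq f p.1 x - diffq f p.2 x| <= k.+1%:R^-1].

Lemma diffq_continuous {R : realType} (f : R -> R) (h : R) :
  continuous f -> continuous (diffq f h).
Proof.
move=> fc x; apply: cvgZl_tmp; apply: cvgB; last exact: fc.
apply: (@continuous_comp _ _ _ (fun x => h + x) f); last exact: fc.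
by apply: cvgD; [exact: cvg_cst|exact: cvg_id].
Qed.

Lemma osc_diffq_le_closed {R : realType} (f : R -> R) (k n : nat) :
  continuous f -> closed (osc_diffq_le f k n).
Proof.
move=> fc; apply: closed_bigI => p _.
apply: (@preimage_closed _ _ (fun x => `|diffq f p.1 x - diffq f p.2 x|)
   [set y | y <= k.+1%:R^-1]); last exact: closed_le.
move=> x _; apply: cvg_norm; apply: cvgB; exact: diffq_continuous.
Qed.

(* By Cauchy's criterion; each osc_diffq_le f k n is closed, being an
   intersection of closed sets, even though p ranges over an uncountable set. *)
Lemma cvg_diffqE {R : realType} (f : R -> R) :
  [set x | cvg (diffq f ^~ x @ 0^')] =
  \bigcap_k \bigcup_n osc_diffq_le f k n.
Proof.
apply/seteqP; split => [x /cvg_ex[l fl] k _|x fx] /=.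
- rewrite /osc_diffq_le; set e := k.+1%:R^-1.
  have e0 : 0 < e / 2 by rewrite divr_gt0// invr_gt0.
  move/cvgrPdist_lt/(_ _ e0) : fl => -[d /= d0 fl].
  near \oo => n.
  have nd : n.+1%:R^-1 < d :> R.
    by near: n; exact: (near_infty_natSinv_lt (PosNum d0)).
  exists n => // -[h h'] /= [h0 h'0 hn h'n].
  have H u : u != 0 -> `|u| < n.+1%:R^-1 -> `|l - diffq f u x| < e / 2.
    move=> u0 un; apply: fl => //=.
    by rewrite sub0r normrN (lt_trans un).
  have := H _ h0 hn; have := H _ h'0 h'n; rewrite !ltr_norml ler_norml.
  by move=> /andP[? ?] /andP[? ?]; apply/andP; split; lra.
- apply/cauchy_cvgP/cauchy_exP => e e0.
  near \oo => k.
  have ke : k.+1%:R^-1 < e.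
    by near: k; exact: (near_infty_natSinv_lt (PosNum e0)).
  have [n _ fn] := fx k I.
  have n0 : 0 < n.+1%:R^-1 :> R by rewrite invr_gt0.
  (* Any quotient with an allowed increment can be the centre of the ball; half of the bound is a
     nonzero increment strictly below it. *)
  exists (diffq f (n.+1%:R^-1 / 2) x).
  suff: \forall h \near 0^',
      ball (diffq f (n.+1%:R^-1 / 2) x) e (diffq f h x) by [].
  near=> h; apply: le_lt_trans ke.
  apply: (fn (n.+1%:R^-1 / 2, h)); split => /=.
  + by rewrite gt_eqF// divr_gt0.
  + by near: h; exact: nbhs_dnbhs_neq.
  + by rewrite gtr0_norm ?divr_gt0// gtr_pMr// invf_lt1// ltr1n.
  + by near: h; exact: dnbhs0_lt.
Unshelve. all: by end_near. Qed.

(** The set [C] of points of derivability is Borel, being a countable intersection of countable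
    unions of closed sets; the derivative is then a pointwise limit of measurable functions. *)
Lemma measurable_derive1 {R : realType} (f : R -> R) :
  continuous f -> measurable_fun setT (derive1 f).
Proof.
move=> fc; pose C := [set x | cvg (diffq f ^~ x @ 0^')].
have mC : measurable C.
  rewrite /C cvg_diffqE; apply: bigcapT_measurable => k.
  apply: bigcupT_measurable => n; apply: closed_measurable.
  exact: osc_diffq_le_closed.
(* The indicator makes the sequence converge everywhere: to the derivative on [C], to 0 off it. *)
apply: (@measurable_fun_cvg _ _ _ _ (fun n x => \1_C x * diffq f n.+1%:R^-1 x)).
  move=> n; apply: measurable_funM; first exact: measurable_indic.
  by apply: continuous_measurable_fun; exact: diffq_continuous.
move=> x _; have [xC|xC] := pselect (C x).
  rewrite indicE mem_set//.
  have -> : (fun n : nat => true%:R * diffq f n.+1%:R^-1 x) =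
      (diffq f ^~ x) \o (fun n => n.+1%:R^-1).
    by apply/funext => n /=; rewrite mul1r.
  apply: (cvg_comp _ _ _ xC).
  move=> A [d /= d0 dA]; near=> n; apply: dA => //=.
  rewrite sub0r normrN gtr0_norm ?invr_gt0//.
  by near: n; exact: (near_infty_natSinv_lt (PosNum d0)).
rewrite indicE memNset//.
(* Where f is not derivable, derive1 f takes the junk value 0. *)
have -> : derive1 f x = 0 by exact: dvgP.
have -> : (fun n : nat => false%:R * diffq f n.+1%:R^-1 x) = cst 0.
  by apply/funext => n /=; rewrite mul0r.
exact: cvg_cst.
Unshelve. all: by end_near. Qed.

Lemma absolutely_continuous_measurable_derive1 {R : realType} (a b : R)
    (f : R -> R) :
  a <= b -> absolutely_continuous a b f ->
  measurable_fun (`[a, b] : set R) (derive1 f).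
Proof.
(* The flags select the open interval, where [f] and [f \o clamp a b] agree near each point and so
   have the same derivative; at the endpoints [derive1 f] sees values outside [[a, b]]. *)
move=> ab fac; apply: (@measurable_fun_itv_cc _ _ _ false true).
apply: (eq_measurable_fun (derive1 (f \o clamp a b))).
  move=> x; rewrite inE/= => xab; rewrite !derive1E; apply: near_eq_derive.
  near=> y; rewrite /= clamp_id//.
  have : y \in `]a, b[ by near: y; exact: near_in_itvoo.
  by rewrite in_itv/= => /andP[/ltW-> /ltW->].
apply: measurable_funTS; apply: measurable_derive1.
exact: absolutely_continuous_clamp.
Unshelve. all: by end_near. Qed.

(** On positive values the inverse is the real power of exponent -1, a measurable function. *)
Lemma measurable_funV_gt0 {d} {T : measurableType d} {R : realType} (D : set T)
    (f : T -> R) :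
  (forall x, D x -> 0 < f x) -> measurable_fun D f ->
  measurable_fun D (fun x => (f x)^-1).
Proof.
move=> f0 mf; apply: (eq_measurable_fun (fun x => f x `^ (-1))).
  by move=> x /set_mem/f0/ltW; exact: powR_inv1.
exact: (measurableT_comp (measurable_powR (-1))).
Qed.

Lemma measurable_comp_expR {R : realType} (D : set R) (u f : R -> R) :
  measurable D -> measurable_fun (`]0, +oo[ : set R) u -> measurable_fun D f ->
  measurable_fun D (fun x => u (expR (f x))).
Proof.
move=> mD mu mf; apply: (measurable_comp _ _ mu) => //.
  by move=> _ [x _ <-] /=; rewrite in_itv/= expR_gt0.
exact: measurableT_comp.
Qed.

(** * Pointwise bounds on the quadratic form *)

Definition energy {R : realType} (rho x y : R) : R :=
  (2 * (1 - rho ^+ 2))^-1 * (x - rho * y) ^+ 2 + 2^-1 * y ^+ 2.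

Lemma energy_coef_ge0 {R : realType} (rho : R) :
  `|rho| < 1 -> 0 <= (2 * (1 - rho ^+ 2))^-1.
Proof.
move=> rho1; rewrite invr_ge0 mulr_ge0// subr_ge0 -real_normK ?num_real//.
by rewrite expr_le1// ltW.
Qed.

Lemma energy_ge0 {R : realType} (rho x y : R) :
  `|rho| < 1 -> 0 <= energy rho x y.
Proof.
by move=> rho1; rewrite addr_ge0// mulr_ge0 ?sqr_ge0// energy_coef_ge0.
Qed.

(** The two contributions to the coefficient of y^2 add up because rho^2 / (1 - rho^2) + 1 = 1 / (1
    - rho^2). The denominator is factored so that each bound cancels one factor. *)
Lemma energyE {R : realType} (rho x y : R) : `|rho| < 1 ->
  energy rho x y = (2 * (1 - `|rho|) * (1 + `|rho|))^-1
    * (x ^+ 2 - 2 * rho * x * y + y ^+ 2).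
Proof.
move=> rho1; have r2 : rho ^+ 2 = `|rho| ^+ 2 by rewrite real_normK ?num_real.
have ? : 1 - `|rho| != 0 by rewrite subr_eq0 gt_eqF.
have ? : 1 + `|rho| != 0 by rewrite gt_eqF// ltr_pwDl.
have ? : 1 - `|rho| ^+ 2 != 0 by rewrite -[1](expr1n _ 2) subr_sqr mulf_neq0.
rewrite /energy sqrrB exprMn r2; field.
by apply/and3P.
Qed.

(** Both signs come from the squares (x + y)^2 and (x - y)^2 being nonnegative. *)
Lemma cross_term_bound {R : realType} (rho x y : R) :
  `|2 * rho * x * y| <= `|rho| * (x ^+ 2 + y ^+ 2).
Proof.
rewrite -mulrA (mulrC 2) -mulrA normrM ler_wpM2l// ler_norml.
apply/andP; split; rewrite -subr_ge0.
  by rewrite [leRHS](_ : _ = (x + y) ^+ 2) ?sqr_ge0//; ring.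
by rewrite [leRHS](_ : _ = (x - y) ^+ 2) ?sqr_ge0//; ring.
Qed.

Lemma energy_lower {R : realType} (rho x y : R) : `|rho| < 1 ->
  (1 + `|rho|)^-1 * energy 0 x y <= energy rho x y.
Proof.
move=> rho1; have r0 := normr_ge0 rho.
have c0 : 0 < 2 * (1 - `|rho|) * (1 + `|rho|).
  by rewrite !mulr_gt0//; lra.
rewrite (energyE rho)// [leLHS](_ : _ =
  (2 * (1 - `|rho|) * (1 + `|rho|))^-1 * ((1 - `|rho|) * (x ^+ 2 + y ^+ 2))).
  rewrite ler_pM2l ?invr_gt0//.
  by have := cross_term_bound rho x y; rewrite ler_norml => /andP[_]; lra.
by rewrite /energy; field; apply/andP; split; lra.
Qed.

(** The constant multiplies the left side, the form that [rate_le] takes with [rho] and 0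
    exchanged. *)
Lemma energy_upper {R : realType} (rho x y : R) : `|rho| < 1 ->
  (1 - `|rho|) * energy rho x y <= energy 0 x y.
Proof.
move=> rho1; have r0 := normr_ge0 rho.
have c0 : 0 < 2 * (1 + `|rho|).
  by rewrite !mulr_gt0//; lra.
rewrite (energyE rho)// [leRHS](_ : _ =
  (2 * (1 + `|rho|))^-1 * ((1 + `|rho|) * (x ^+ 2 + y ^+ 2))); last first.
  by rewrite /energy; field; lra.
rewrite [leLHS](_ : _ = (2 * (1 + `|rho|))^-1
    * (x ^+ 2 - 2 * rho * x * y + y ^+ 2)); last first.
  by field; apply/andP; split; lra.
rewrite ler_pM2l ?invr_gt0//.
by have := cross_term_bound rho x y; rewrite ler_norml => /andP[+ _]; lra.
Qed.

(** * The functional as a single integral *)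

Definition price_speed {R : realType} (eta g h : R -> R) (t : R) : R :=
  derive1 g t / (eta (expR (g t)) * Num.sqrt (expR (h t))).

Definition variance_speed {R : realType} (sigma h : R -> R) (t : R) : R :=
  derive1 h t / sigma (expR (h t)).

Lemma measurable_price_speed {R : realType} {eta : R -> R}
    (eta_gt0 : forall x : R, 0 < x -> 0 < eta x)
    (eta_meas : measurable_fun (`]0, +oo[ : set R) eta)
    (g h : R -> R) :
  absolutely_continuous 0 1 g -> absolutely_continuous 0 1 h ->
  measurable_fun (`[0, 1] : set R) (price_speed eta g h).
Proof.
move=> gac hac; apply: measurable_funM.
  exact: absolutely_continuous_measurable_derive1.
apply: measurable_funV_gt0.
  by move=> t _; rewrite mulr_gt0 ?sqrtr_gt0 ?eta_gt0 ?expR_gt0.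
apply: measurable_funM; apply: measurable_comp_expR => //;
  try exact: absolutely_continuous_measurable.
by apply: measurable_funTS; apply: continuous_measurable_fun;
  exact: sqrt_continuous.
Qed.

Lemma measurable_variance_speed {R : realType} {sigma : R -> R}
    (sigma_gt0 : forall x : R, 0 < x -> 0 < sigma x)
    (sigma_meas : measurable_fun (`]0, +oo[ : set R) sigma)
    (h : R -> R) :
  absolutely_continuous 0 1 h ->
  measurable_fun (`[0, 1] : set R) (variance_speed sigma h).
Proof.
move=> hac; apply: measurable_funM.
  exact: absolutely_continuous_measurable_derive1.
apply: measurable_funV_gt0; first by move=> t _; rewrite sigma_gt0 ?expR_gt0.
apply: measurable_comp_expR => //; exact: absolutely_continuous_measurable.
Qed.

(** Additivity and homogeneity of the integral of nonnegative measurable functions also cover paths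
    of infinite energy. *)
Lemma LambdaE {R : realType} {eta sigma : R -> R}
    (eta_gt0 : forall x : R, 0 < x -> 0 < eta x)
    (eta_meas : measurable_fun (`]0, +oo[ : set R) eta)
    (sigma_gt0 : forall x : R, 0 < x -> 0 < sigma x)
    (sigma_meas : measurable_fun (`]0, +oo[ : set R) sigma)
    (rho : R) (g h : R -> R) :
  `|rho| < 1 ->
  absolutely_continuous 0 1 g -> absolutely_continuous 0 1 h ->
  (Lambda eta sigma rho g h =
   \int[lebesgue_measure]_(t in `[0%R, 1%R])
     (energy rho (price_speed eta g h t) (variance_speed sigma h t))%:E)%E.
Proof.
move=> rho1 gac hac.
have mX := measurable_price_speed eta_gt0 eta_meas g h gac hac.
have mY := measurable_variance_speed sigma_gt0 sigma_meas h hac.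
have c0 := energy_coef_ge0 rho rho1.
have mX2 : measurable_fun (`[0, 1] : set R)
    (fun t => (price_speed eta g h t - rho * variance_speed sigma h t) ^+ 2).
  apply: measurable_funX; apply: measurable_funB => //.
  exact: measurable_funM.
have mY2 : measurable_fun (`[0, 1] : set R)
    (fun t => variance_speed sigma h t ^+ 2).
  exact: measurable_funX.
rewrite /energy; under eq_integral do rewrite EFinD.
rewrite ge0_integralD//; last 4 first.
- by move=> t _; rewrite lee_fin mulr_ge0// sqr_ge0.
- by apply/measurable_EFinP; exact: measurable_funM.
- by move=> t _; rewrite lee_fin mulr_ge0// sqr_ge0.
- by apply/measurable_EFinP; exact: measurable_funM.
under eq_integral do rewrite EFinM.
under [X in (_ + X)%E]eq_integral do rewrite EFinM.
rewrite !ge0_integralZl_EFin//; last 4 first.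
- by move=> t _; rewrite lee_fin sqr_ge0.
- exact/measurable_EFinP.
- by move=> t _; rewrite lee_fin sqr_ge0.
- exact/measurable_EFinP.
rewrite /Lambda; congr (_ * _ + _)%E.
by apply: eq_integral => t _; rewrite /variance_speed mulrA.
Qed.

Lemma measurable_energy {R : realType} {eta sigma : R -> R}
    (eta_gt0 : forall x : R, 0 < x -> 0 < eta x)
    (eta_meas : measurable_fun (`]0, +oo[ : set R) eta)
    (sigma_gt0 : forall x : R, 0 < x -> 0 < sigma x)
    (sigma_meas : measurable_fun (`]0, +oo[ : set R) sigma)
    (rho : R) (g h : R -> R) :
  absolutely_continuous 0 1 g -> absolutely_continuous 0 1 h ->
  measurable_fun (`[0, 1] : set R)
    (fun t => energy rho (price_speed eta g h t) (variance_speed sigma h t)).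
Proof.
move=> gac hac.
have mX := measurable_price_speed eta_gt0 eta_meas g h gac hac.
have mY := measurable_variance_speed sigma_gt0 sigma_meas h hac.
apply: measurable_funD; apply: measurable_funM => //;
  apply: measurable_funX => //.
by apply: measurable_funB => //; exact: measurable_funM.
Qed.

(** * Comparison of the infima *)

(** The admissible set does not depend on the correlation, so each admissible pair for [r2] also
    competes in the infimum for [r1]; the pointwise bound is integrated along it. *)
Lemma rate_le {R : realType} {eta sigma : R -> R}
    (eta_gt0 : forall x : R, 0 < x -> 0 < eta x)
    (eta_meas : measurable_fun (`]0, +oo[ : set R) eta)
    (sigma_gt0 : forall x : R, 0 < x -> 0 < sigma x)
    (sigma_meas : measurable_fun (`]0, +oo[ : set R) sigma)
    (c r1 r2 S0 V0 K : R) : 0 < c -> `|r1| < 1 -> `|r2| < 1 ->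
  (forall x y, c * energy r1 x y <= energy r2 x y) ->
  (c%:E * rate eta sigma r1 S0 V0 K <= rate eta sigma r2 S0 V0 K)%E.
Proof.
move=> c0 r1lt1 r2lt1 cE; apply/ereal_infP => _ [[g h] gh_adm <-] /=.
have [/= gac hac _ _ _] := gh_adm.
apply: (@le_trans _ _ (c%:E * Lambda eta sigma r1 g h)%E).
  (* As [c] is finite and positive, it cancels even when the values are infinite. *)
  by rewrite lee_pmul2l//; apply: ereal_inf_lbound; exists (g, h).
rewrite !LambdaE// -ge0_integralZl_EFin//; last 3 first.
- by move=> t _; rewrite lee_fin energy_ge0.
- by apply/measurable_EFinP; exact: measurable_energy.
- exact: ltW.
apply: ge0_le_integral => //.
- by move=> t _; rewrite -EFinM lee_fin mulr_ge0 ?energy_ge0// ltW.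
- by apply: measurable_funeM; apply/measurable_EFinP; exact: measurable_energy.
- by apply/measurable_EFinP; exact: measurable_energy.
- by move=> t _; rewrite -EFinM lee_fin.
Qed.

Theorem proposition11 (R : realType) (eta sigma : R -> R)
    (eta_gt0 : forall x : R, 0 < x -> 0 < eta x)
    (sigma_gt0 : forall x : R, 0 < x -> 0 < sigma x)
    (eta_meas : measurable_fun (`]0, +oo[ : set R) eta)
    (sigma_meas : measurable_fun (`]0, +oo[ : set R) sigma)
    (S0 V0 K : R) (S0_gt0 : 0 < S0) (V0_gt0 : 0 < V0) (K_gt0 : 0 < K)
    (rho : R) (rho_gtN1 : -1 < rho) (rho_lt1 : rho < 1) :
  (((1 + `|rho|)^-1)%:E * rate eta sigma 0 S0 V0 K
     <= rate eta sigma rho S0 V0 K)%E /\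
  (rate eta sigma rho S0 V0 K
     <= ((1 - `|rho|)^-1)%:E * rate eta sigma 0 S0 V0 K)%E.
Proof.
have rho1 : `|rho| < 1 by rewrite ltr_norml rho_gtN1.
have zero1 : `|0 : R| < 1 by rewrite normr0.
split.
  by apply: rate_le => // x y; exact: energy_lower.
(* Moving the positive factor to the other side turns the upper bound into a lower bound for the
   rate at 0. *)
rewrite lee_pdivlMl ?subr_gt0//.
by apply: rate_le => // [|x y]; [rewrite subr_gt0|exact: energy_upper].
Qed.
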